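(* For $a=(a_k)_{k\in\mathbb{N}}\in\omega$ let $B=(b_{nk})_{n,k\in\mathbb{N}}$ be the infinite matrix given by $$b_{nk}=\begin{cases}(n+1)a_n, & k=n,\\ a_n, & 0\le k<n,\\ 0, & k>n.\end{cases}$$ Then the $\alpha$-dual of the space $bv(C)$ is $$[bv(C)]^{\alpha}=\Big\{a=(a_k)\in\omega:\ \sup_{k\in\mathbb{N}}\sum_{n}|b_{nk}|<\infty\Big\}.$$
   Context: $\mathbb{N}=\{0,1,2,\ldots\}$, $\omega=\mathbb{C}^{\mathbb{N}}$ is the space of all complex sequences, and sums without limits run from $0$ to $\infty$. $\ell_1$ is the space of absolutely summable complex sequences. The space of sequences of bounded variation is $bv=\{x\in\omega:\sum_{k=1}^{\infty}|x_k-x_{k-1}|<\infty\}$. The space $bv(C)$ is the matrix domain in $bv$ of the Cesàro matrix of order one: $bv(C)=\{x=(x_k)\in\omega:(\frac{1}{k+1}\sum_{j=0}^{k}x_j)_{k\in\mathbb{N}}\in bv\}$. For a set $X\subset\omega$ of sequences, the $\alpha$-dual is $X^{\alpha}=\{a=(a_k)\in\omega:(a_kx_k)_{k}\in\ell_1\text{ for all }x\in X\}$. *)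

(* Defs.v *)
From mathcomp Require Import all_boot all_order all_algebra.
From mathcomp Require Export complex.
From mathcomp Require Import all_classical all_reals all_analysis.
Import GRing.Theory Num.Theory.

Set Implicit Arguments.
Unset Strict Implicit.
Unset Printing Implicit Defensive.

Local Open Scope classical_set_scope.
Local Open Scope ring_scope.

Section SequenceSpaces.
Variable R : realType.

(* [ComplexField.normc z : R] is the modulus of z as an element of R; on R[i]
   the notation [`|z|] denotes the same number, but as an element of R[i]. *)
Definition ell1 : set (nat -> R[i]) :=
  [set x | (\sum_(0 <= k <oo) (ComplexField.Normc.normc (x k))%:E < +oo)%E].

Definition bv : set (nat -> R[i]) :=
  [set x | (\sum_(1 <= k <oo)
              (ComplexField.Normc.normc (x k - x k.-1)%R)%:E < +oo)%E].

(* [arithmetic_mean x k] is (x 0 + ... + x k) / (k + 1), the k-th term of the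
   Cesaro transform of order one of x. *)
Definition bvC : set (nat -> R[i]) :=
  [set x | bv (arithmetic_mean x)].

Definition alpha_dual (X : set (nat -> R[i])) : set (nat -> R[i]) :=
  [set a | forall x, X x -> ell1 (fun k => a k * x k)].

Definition Bmat (a : nat -> R[i]) (n k : nat) : R[i] :=
  if k == n then n.+1%:R * a n else if (k < n)%N then a n else 0.

End SequenceSpaces.

Arguments bvC R : clear implicits.

(* Main.v *)
(* Write [t] for the increments (with t_0 = y_0) of the Cesaro means y of x.
   Then x_n = (n+1) t_n + t_0 + ... + t_(n-1), so that a_n x_n = (B t)_n, and x is
   in bv(C) iff t is in l_1: the alpha-dual consists of the a for which B maps
   l_1 to l_1.  A uniform bound on the l_1 norms of the columns of B suffices.
   For the converse, testing on the nonnegative t in l_1, where no cancellation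
   occurs, gives both that a is in l_1 (take t = e_0) and that (n+1)|a_n| t_n is
   summable for every such t, hence that (n+1)|a_n| is bounded. *)
Require Import Defs.
From mathcomp Require Import all_boot all_order all_algebra.
From mathcomp Require Import complex.
From mathcomp Require Import all_classical all_reals all_analysis.
From mathcomp Require Import ring.
Import Order.TTheory GRing.Theory Num.Theory.
Import ComplexField.

Local Open Scope classical_set_scope.
Local Open Scope ring_scope.

Lemma nneseries_EFin_ltyP (R : realType) (f : nat -> R) (m : nat) :
  (forall n, 0 <= f n) ->
  (\sum_(m <= k <oo) (f k)%:E < +oo)%E <->
  exists C, forall n, \sum_(m <= k < n) f k <= C.
Proof.
move=> f0; have fE0 k : (0 <= (f k)%:E)%E by rewrite lee_fin.
split=> [foo|[C fC]].
- exists (fine (\sum_(m <= k <oo) (f k)%:E)%E) => n.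
  rewrite -lee_fin fineK.
    by rewrite -sumEFin; exact: nneseries_lim_ge.
  by rewrite ge0_fin_numE//; exact: nneseries_ge0.
- apply: (@le_lt_trans _ _ C%:E); last exact: ltry.
  apply: lime_le; first exact: is_cvg_nneseries.
  by apply: nearW => n; rewrite sumEFin lee_fin.
Qed.

Section Modulus.
Variable R : realType.
Implicit Types z : R[i].

Lemma normc_ge0 z : 0 <= Normc.normc z.
Proof. by case: z => x y; exact: sqrtr_ge0. Qed.

Lemma normc_real (r : R) : 0 <= r -> Normc.normc r%:C%C = r.
Proof. by move=> r0; rewrite /= expr0n addr0 sqrtr_sqr ger0_norm. Qed.

Lemma ler_normc_sum (I : Type) (s : seq I) (P : pred I) (F : I -> R[i]) :
  Normc.normc (\sum_(i <- s | P i) F i) <= \sum_(i <- s | P i) Normc.normc (F i).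
Proof.
elim/big_ind2: _ => //; first by rewrite Normc.normc0.
by move=> x a y b xa yb; exact: le_trans (le_normcD _ _) (lerD xa yb).
Qed.

End Modulus.

(** Starting at 1 keeps every value positive, so reciprocals exist, and makes the telescoping sum of
    their differences at most 1. *)
Fixpoint running_max (R : realType) (u : nat -> R) (n : nat) : R :=
  if n is k.+1 then Num.max (running_max R u k) (u k) else 1.

(* With [M] the running maximum of [u], the test sequence is
   [d k = 1 / M k - 1 / M k.+1], whose sum telescopes; as
   [1 + u k * d k = M k.+1 / M k], the product of these factors is [M n], so
   that [M n <= expR (\sum_(k < n) u k * d k)]. *)
Lemma bounded_of_summable_tests (R : realType) (u : nat -> R) :
  (forall d : nat -> R, (forall k, 0 <= d k) ->
     (forall n, \sum_(0 <= k < n) d k <= 1) ->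
     exists C, forall n, \sum_(0 <= k < n) u k * d k <= C) ->
  exists M, forall n, u n <= M.
Proof.
move=> tests; pose M := running_max R u.
have MS n : M n.+1 = Num.max (M n) (u n) by [].
have M1 n : 1 <= M n.
  by elim: n => [|n IH]; rewrite ?MS ?le_max ?IH//= lexx.
have M0 n : 0 < M n by rewrite (lt_le_trans ltr01).
have leMS n : M n <= M n.+1 by rewrite MS le_max lexx.
pose d k := (M k)^-1 - (M k.+1)^-1.
have sum_d n : \sum_(0 <= k < n) d k = 1 - (M n)^-1.
  rewrite (telescope_sumr_eq (fun k => - (M k)^-1))//.
    by rewrite opprK invr1 addrC.
  by move=> k _; rewrite opprK addrC.
have [k|n|C udC] := tests d.
- by rewrite subr_ge0 lef_pV2// posrE.
- by rewrite sum_d gerBl invr_ge0 ltW.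
have step n : M n.+1 = M n * (1 + u n * d n).
  have Mn0 := lt0r_neq0 (M0 n).
  (* Either the maximum stays and [d n = 0], or [u n] is the new maximum and
     [u n * d n = u n / M n - 1]. *)
  have [uM|Mu] := leP (u n) (M n).
    have ME : M n.+1 = M n by rewrite MS max_l.
    by rewrite /d ME subrr mulr0 addr0 mulr1.
  have ME : M n.+1 = u n by rewrite MS max_r// ltW.
  have un0 : u n != 0 by rewrite -ME lt0r_neq0.
  by rewrite /d ME; field; rewrite Mn0 un0.
have Mexp n : M n <= expR (\sum_(0 <= k < n) u k * d k).
  elim: n => [|n IH]; first by rewrite big_geq// expR0.
  rewrite step big_nat_recr//= expRD ler_pM//.
  - exact: ltW.
  (* As [u n] may be negative, the sign of the factor is read off from [M n > 0] and
     [M n.+1 > 0]. *)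
  - by rewrite -(pmulr_rge0 _ (M0 n)) -step ltW.
  - exact: expR_ge1Dx.
exists (expR C) => n; apply: (@le_trans _ _ (M n.+1)).
  by rewrite MS le_max lexx orbT.
by rewrite (le_trans (Mexp _))// ler_expR.
Qed.

Section Cesaro.
Variable R : realType.
Implicit Types (a x y : nat -> R[i]) (d : nat -> R).

Definition increment y (k : nat) : R[i] :=
  if k is k'.+1 then y k - y k' else y 0%N.

Lemma sum_increment y n : \sum_(0 <= k < n.+1) increment y k = y n.
Proof.
by elim: n => [|n IH]; rewrite big_nat_recr//= ?IH ?big_geq ?add0r ?subrKC.
Qed.

(** The series defining [bv] starts at index 1; the extra increment [y 0] only shifts the bound. *)
Lemma bv_incrementP y :
  bv y <-> exists D, forall n, \sum_(0 <= k < n) Normc.normc (increment y k) <= D.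
Proof.
rewrite /bv /= nneseries_EFin_ltyP; last by move=> n; exact: normc_ge0.
have E n : \sum_(1 <= k < n.+1) Normc.normc (y k - y k.-1) =
           \sum_(0 <= k < n) Normc.normc (y k.+1 - y k) by rewrite big_add1.
split=> -[D yD].
- exists (Normc.normc (y 0%N) + D) => -[|n].
    by rewrite big_geq// addr_ge0 ?normc_ge0// (le_trans _ (yD 0%N))// big_geq.
  by rewrite big_nat_recl//= lerD2l -E.
- exists D => -[|n]; first by rewrite big_geq// (le_trans _ (yD 0%N))// big_geq.
  rewrite E (le_trans _ (yD n.+1))// [leRHS]big_nat_recl//= lerDr.
  exact: normc_ge0.
Qed.

Lemma arithmetic_meanE x n :
  arithmetic_mean x n = n.+1%:R^-1 * \sum_(0 <= k < n.+1) x k.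
Proof. by rewrite /arithmetic_mean /= seriesEnat. Qed.

(** With [y] the means, [x n = (n+1) y_n - n y_(n-1) = (n+1) (y_n - y_(n-1)) + y_(n-1)], and the
    last term is a telescoped sum of increments. *)
Lemma increment_meanK x n :
  x n = n.+1%:R * increment (arithmetic_mean x) n +
        \sum_(0 <= k < n) increment (arithmetic_mean x) k.
Proof.
have sumx m : \sum_(0 <= k < m.+1) x k = m.+1%:R * arithmetic_mean x m.
  by rewrite arithmetic_meanE mulrA divff ?mul1r ?pnatr_eq0.
have := sumx n; rewrite big_nat_recr//= => /(canRL (addKr _)) ->.
case: n => [|n]; first by rewrite !big_geq// oppr0 add0r addr0.
rewrite sum_increment sumx /=.
by rewrite -[in LHS](natr1 n.+1) -[in RHS](natr1 n.+1); ring.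
Qed.

(** With [S_k] the sum of the [t j] for [j < k], the averaged terms are [(k+1) S_(k+1) - k S_k],
    which telescope. *)
Lemma mean_of_increments (F : numFieldType) (t : nat -> F) n :
  arithmetic_mean (fun k => k.+1%:R * t k + \sum_(0 <= j < k) t j) n =
  \sum_(0 <= k < n.+1) t k.
Proof.
rewrite /arithmetic_mean /= seriesEnat /=.
rewrite (telescope_sumr_eq (fun k => k%:R * \sum_(0 <= j < k) t j))//.
  by rewrite mul0r subr0 mulrA mulVf ?mul1r ?pnatr_eq0.
by move=> k _; rewrite big_nat_recr//= -natr1; ring.
Qed.

(** Rows vanish beyond the diagonal, so one truncation [N] serves all rows [n < N]; the double sum
    to be exchanged later is then finite. *)
Lemma sum_Bmat a (t : nat -> R[i]) n N : (n < N)%N ->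
  \sum_(0 <= k < N) Bmat a n k * t k =
  a n * (n.+1%:R * t n + \sum_(0 <= k < n) t k).
Proof.
move=> nN.
have tail0 : \sum_(n.+1 <= k < N) Bmat a n k * t k = 0.
  rewrite big_nat_cond big1// => k /andP[/andP[nk _] _].
  by rewrite /Bmat gtn_eqF// ltnNge ltnW// mul0r.
rewrite (big_cat_nat (n := n.+1))//= tail0 addr0 big_nat_recr//= {2}/Bmat eqxx.
rewrite mulrDr mulrA [a n * _]mulrC addrC; congr (_ + _).
rewrite mulr_sumr; apply: eq_big_nat => k /andP[_ kn].
by rewrite /Bmat kn ltn_eqF.
Qed.

Lemma normc_Bmat_le a n k :
  Normc.normc (Bmat a n k) <=
  (if k == n then n.+1%:R * Normc.normc (a n) else 0) + Normc.normc (a n).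
Proof.
have nn (m : nat) : Normc.normc (m%:R : R[i]) = m%:R.
  by rewrite -(normc_real R m%:R)// rmorph_nat.
rewrite /Bmat; case: eqP => [_|_].
  by rewrite Normc.normcM nn lerDl normc_ge0.
by rewrite add0r; case: ifP => // _; rewrite Normc.normc0 normc_ge0.
Qed.

Lemma column_bound_alpha_dual a (C : R) :
  (forall k N, \sum_(0 <= n < N) Normc.normc (Bmat a n k) <= C) ->
  alpha_dual (bvC R) a.
Proof.
move=> aC x /bv_incrementP[D]; set t := increment _ => tD.
apply/nneseries_EFin_ltyP; first by move=> n; exact: normc_ge0.
have C0 : 0 <= C by rewrite (le_trans _ (aC 0%N 0%N))// big_geq.
exists (C * D) => N.
apply: (@le_trans _ _ (\sum_(0 <= n < N) \sum_(0 <= k < N)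
    Normc.normc (Bmat a n k) * Normc.normc (t k))).
  apply: ler_sum_nat => n /andP[_ nN].
  rewrite (increment_meanK x) -/t -(sum_Bmat _ _ _ N)//.
  rewrite (le_trans (ler_normc_sum _ _ _ _ _))//.
  by apply: ler_sum => k _; rewrite Normc.normcM.
rewrite exchange_big/= (@le_trans _ _ (\sum_(0 <= k < N) C * Normc.normc (t k)))//.
  by apply: ler_sum => k _; rewrite -mulr_suml ler_wpM2r ?normc_ge0.
by rewrite -mulr_sumr ler_wpM2l.
Qed.

(** The sequence [x] whose means have increments [d] lies in [bvC], and its terms, being nonnegative
    reals, equal their moduli. *)
Lemma alpha_dual_nneg_increments a d (D : R) :
  alpha_dual (bvC R) a -> (forall k, 0 <= d k) ->
  (forall n, \sum_(0 <= k < n) d k <= D) ->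
  exists C, forall N, \sum_(0 <= n < N)
    Normc.normc (a n) * (n.+1%:R * d n + \sum_(0 <= k < n) d k) <= C.
Proof.
move=> aX d0 dD; pose t k : R[i] := (d k)%:C%C.
pose x n := n.+1%:R * t n + \sum_(0 <= k < n) t k.
have tE k : increment (arithmetic_mean x) k = t k.
  case: k => [|k]; rewrite /= !mean_of_increments; first by rewrite big_nat1.
  by rewrite big_nat_recr// addrC; exact: addKr.
have xE n : Normc.normc (x n) = n.+1%:R * d n + \sum_(0 <= k < n) d k.
  have -> : x n = (n.+1%:R * d n + \sum_(0 <= k < n) d k)%:C%C.
    by rewrite rmorphD rmorphM rmorph_nat rmorph_sum.
  by rewrite normc_real// addr_ge0 ?mulr_ge0 ?sumr_ge0.
have /aX /nneseries_EFin_ltyP[n|C aC] : bvC R x.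
- apply/bv_incrementP; exists D => n.
  by under eq_bigr do rewrite tE normc_real//.
- exact: normc_ge0.
- exists C => N; rewrite (le_trans _ (aC N))//.
  by apply: ler_sum => n _; rewrite Normc.normcM xE.
Qed.

Lemma alpha_dual_column_bound a :
  alpha_dual (bvC R) a ->
  exists C, forall k N, \sum_(0 <= n < N) Normc.normc (Bmat a n k) <= C.
Proof.
move=> aX.
have [M aM] : exists M, forall n, n.+1%:R * Normc.normc (a n) <= M.
  apply: bounded_of_summable_tests => d d0 d1.
  have [C aC] := alpha_dual_nneg_increments a d 1 aX d0 d1.
  exists C => n; rewrite (le_trans _ (aC n))//; apply: ler_sum => k _.
  by rewrite -mulrA [leLHS]mulrCA ler_wpM2l ?normc_ge0// lerDl sumr_ge0.
have [C aC] : exists C, forall N, \sum_(0 <= n < N) Normc.normc (a n) <= C.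
  (* For this [d] the weight of [a n] is 1 for every [n]: it comes from the diagonal term at [n = 0]
     and from the sum afterwards. *)
  pose d (k : nat) : R := (k == 0%N)%:R.
  have sum_d n : \sum_(0 <= k < n.+1) d k = 1.
    by rewrite big_nat_recl//= big1 ?addr0.
  have [k|[|n]|C aC] := alpha_dual_nneg_increments a d 1 aX.
  - exact: ler0n.
  - by rewrite big_geq.
  - by rewrite sum_d.
  exists C => N; rewrite (le_trans _ (aC N))//; apply: ler_sum => -[|n] _.
    by rewrite big_geq// addr0 /d eqxx !mulr1.
  by rewrite sum_d /d mulr0 add0r mulr1.
(* Used when [N <= k]: the truncated column then misses the diagonal. Otherwise the diagonal occurs
   once and contributes at most [M]. *)
have M0 : 0 <= M by rewrite (le_trans _ (aM 0%N))// mulr_ge0 ?normc_ge0.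
exists (M + C) => k N.
rewrite (le_trans (ler_sum _ (fun n _ => normc_Bmat_le a n k)))//.
rewrite big_split/= lerD// -big_mkcond/=.
under eq_bigl do rewrite eq_sym.
by rewrite big_nat1_eq; case: ifP.
Qed.

End Cesaro.

Theorem theorem3p2 (R : realType) :
  alpha_dual (bvC R) =
  [set a : nat -> R[i] |
    (ereal_sup [set \sum_(0 <= n <oo)
                      (ComplexField.Normc.normc (Bmat a n k))%:E | k in [set: nat]]
     < +oo)%E].
Proof.
apply/seteqP; split=> a /=.
- move=> /alpha_dual_column_bound[C aC].
  apply: (@le_lt_trans _ _ C%:E); last exact: ltry.
  apply: ge_ereal_sup => _ [k _ <-]; apply: lime_le.
    by apply: is_cvg_nneseries => n _ _; rewrite lee_fin normc_ge0.
  by apply: nearW => N; rewrite sumEFin lee_fin.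
- set S := ereal_sup _ => Soo.
  have colS k : (\sum_(0 <= n <oo) (Normc.normc (Bmat a n k))%:E <= S)%E.
    by apply: ereal_sup_ubound; exists k.
  have nB n k : (0 <= (Normc.normc (Bmat a n k))%:E)%E by rewrite lee_fin normc_ge0.
  apply: (@column_bound_alpha_dual _ _ (fine S)) => k N.
  (* [S] is a real number: it is below infinity and dominates column 0, whose sum is nonnegative. *)
  rewrite -lee_fin fineK; last first.
    by rewrite ge0_fin_numE// (le_trans _ (colS 0%N))// nneseries_ge0.
  by rewrite -sumEFin (le_trans _ (colS k))// nneseries_lim_ge.
Qed.
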